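(* Let $n\ge1$ and index both matrices below by $\pi\in NC^B(n)$, where the Gram-matrix row/column of $\pi$ is the one of $\beta_B(\pi)\in NCM^B(n)$. Then, as an identity of matrices whose entries are functions of $\delta>0$, $$J^B_n(\delta^2)=P^B\,G^B_n(1,\delta)\,P^B,$$ where $P^B$ is diagonal with entry $\delta^{\mathrm{nzbk}(\pi)-n/2}$ in the row of $\pi$. Equivalently, for all $\pi,\pi'\in NC^B(n)$, $$2\,\mathrm{nzbk}(\pi\vee\pi')=c_d\big(\beta_B(\pi)\vee\beta_B(\pi')\big)+\mathrm{nzbk}(\pi)+\mathrm{nzbk}(\pi')-n.$$
   Context: A type $B$ $n$-partition is a partition $\pi$ of $\{+1,\dots,+n,-1,\dots,-n\}$ such that $-K$ is a block whenever $K$ is, with at most one block $K$ satisfying $K=-K$ (a zero, or invariant, block). $\mathrm{bk}_0(\pi)$ is the number of zero blocks and $\mathrm{nzbk}(\pi)$ is half the number of non-zero blocks. Place $+1,\dots,+n,-1,\dots,-n$ anticlockwise at equally spaced points on the boundary circle of a disk, so that $i\mapsto -i$ is the rotation by $\pi$. Using the order $+1<\dots<+n<-1<\dots<-n$, draw a connection chord between $i<j$ when they are in the same block with no element of that block strictly between them; $\pi$ is non-crossing if these chords can be drawn without crossing. $NC^B(n)$ is the set of non-crossing type $B$ $n$-partitions. For $\pi,\pi'\in NC^B(n)$, $\pi\vee\pi'$ is the finest partition of $\{\pm1,\dots,\pm n\}$ coarser than both (it is closed under negation, need not be non-crossing, and may have up to two zero blocks); $\mathrm{bk}_0$ and $\mathrm{nzbk}$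 are defined for it in the same way. The type $B$ matrix of chromatic joins $J^B_n(\delta)$ has $(\pi,\pi')$ entry $\delta^{\mathrm{nzbk}(\pi\vee\pi')}$. $NCM^B(n)$ is the set of non-crossing perfect matchings of $4n$ equally spaced points on a circle that are invariant under rotation by $\pi$. The bijection $\beta_B:NC^B(n)\to NCM^B(n)$: the frontier in the disk of a regular neighborhood of the union of the $2n$ points and the connection chords of $\pi$ consists of $2n$ arcs with $4n$ endpoints on the circle (two near each labeled point), forming $\beta_B(\pi)$. For $b,b'\in NCM^B(n)$, $b\vee b'$ is the family of disjoint circles on the 2-sphere obtained by drawing $b$ in one disk and $b'$ in the complementary disk, glued along the boundary respecting labels; the rotation by $\pi$ of each disk extends to an involution of the sphere fixing the two disk centers. $c_0(b\vee b')$ is the number of circles $C$ with $C=-C$ (zero circles), and $c_d(b\vee b')$ is the number of pairs $\{C,-C\}$ of circles with $C\neq -C$. The type $B$ Temperley–Lieb Gram matrix $G^B_n(\alpha,\delta)$ has $(b,b')$ entry $\alpha^{c_0(b\vee b')}\delta^{c_d(b\vee b')}$. *)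

(* Defs.v *)
From HB Require Import structures.
From mathcomp Require Import all_boot all_order all_algebra.
Set Implicit Arguments. Unset Strict Implicit. Unset Printing Implicit Defensive.
Import Order.TTheory GRing.Theory Num.Theory.

(* Conventions.
   Labels +1,...,+n,-1,...,-n are encoded by p : 'I_(2*n) (in that order):
   p < n encodes +(p+1), n <= p encodes -(p-n+1).  Negation is p |-> p+n mod 2n
   (rotation by pi).  The 4n boundary points of a matching are encoded by
   x : 'I_(4*n): point 2p is the point just before (clockwise of) label p,
   point 2p+1 the point just after it (anticlockwise order = increasing). *)

Lemma rot_proof (m k : nat) (x : 'I_m) : (x + k) %% m < m.
Proof. by rewrite ltn_pmod // (leq_ltn_trans (leq0n x) (ltn_ord x)). Qed.

Definition rot (m k : nat) (x : 'I_m) : 'I_m := Ordinal (rot_proof k x).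
Definition rotset (m k : nat) (A : {set 'I_m}) : {set 'I_m} := [set rot k x | x in A].

Definition negB (n : nat) (K : {set 'I_(2*n)}) := rotset n K.

Definition typeB (n : nat) (P : {set {set 'I_(2*n)}}) : bool :=
  [&& partition P [set: 'I_(2*n)],
      [forall K in P, negB K \in P] &
      #|[set K in P | negB K == K]| <= 1].

Definition chord (m : nat) (P : {set {set 'I_m}}) (i j : 'I_m) : bool :=
  (i < j) && [exists K in P, [&& i \in K, j \in K &
                 [forall k in K, ~~ ((i < k) && (k < j))]]].

Definition noncrossing (m : nat) (P : {set {set 'I_m}}) : bool :=
  [forall a, forall b, forall c, forall d,
     (chord P a b && chord P c d) ==> ~~ [&& a < c, c < b & b < d]].

Definition ncB (n : nat) (P : {set {set 'I_(2*n)}}) : bool :=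
  typeB P && noncrossing P.

Definition joinP (m : nat) (P Q : {set {set 'I_m}}) : {set {set 'I_m}} :=
  equivalence_partition
    (connect (fun x y => [exists K in P, (x \in K) && (y \in K)]
                      || [exists K in Q, (x \in K) && (y \in K)]))
    [set: 'I_m].

Definition nzbk (n : nat) (P : {set {set 'I_(2*n)}}) : nat :=
  #|[set K in P | negB K != K]| %/ 2.

(* next / previous element of the block of p in cyclic (anticlockwise) order;
   p itself for a singleton block *)
Definition nextb (n : nat) (P : {set {set 'I_(2*n)}}) (p : 'I_(2*n)) : 'I_(2*n) :=
  [arg min_(q < p in pblock P p) ((q + 2*n - p - 1) %% (2*n))].
Definition prevb (n : nat) (P : {set {set 'I_(2*n)}}) (p : 'I_(2*n)) : 'I_(2*n) :=
  [arg min_(q < p in pblock P p) ((p + 2*n - q - 1) %% (2*n))].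

Lemma lab_proof (n : nat) (x : 'I_(4*n)) : x./2 < 2*n.
Proof.
have h := ltn_ord x.
rewrite -(ltn_pmul2l (isT : 0 < 2)).
apply: leq_ltn_trans (_ : x < _); last by rewrite mulnA.
by rewrite -{2}(odd_double_half x) -muln2 mulnC leq_addl.
Qed.
Lemma ptm_proof (n : nat) (p : 'I_(2*n)) : 2 * p < 4*n.
Proof.
have -> : 4 * n = 2 * (2 * n) by rewrite mulnA.
by rewrite ltn_pmul2l.
Qed.
Lemma ptp_proof (n : nat) (p : 'I_(2*n)) : (2 * p).+1 < 4*n.
Proof.
have h := ltn_ord p.
have -> : 4 * n = 2 * (2 * n) by rewrite mulnA.
apply: leq_trans (_ : 2 * p.+1 <= _); last by rewrite leq_pmul2l.
by rewrite mulnS.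
Qed.

Definition lab (n : nat) (x : 'I_(4*n)) : 'I_(2*n) := Ordinal (lab_proof x).
Definition ptm (n : nat) (p : 'I_(2*n)) : 'I_(4*n) := Ordinal (ptm_proof p).
Definition ptp (n : nat) (p : 'I_(2*n)) : 'I_(4*n) := Ordinal (ptp_proof p).

(* beta_B(P) as the involution of the 4n boundary points: the frontier arc
   leaving the point just after a goes to the point just before the next
   element of the block of a. *)
Definition betaB (n : nat) (P : {set {set 'I_(2*n)}}) (x : 'I_(4*n)) : 'I_(4*n) :=
  if odd x then ptm (nextb P (lab x)) else ptp (prevb P (lab x)).

Definition circles (n : nat) (b b' : 'I_(4*n) -> 'I_(4*n)) : {set {set 'I_(4*n)}} :=
  equivalence_partition
    (connect (fun x y => [|| b x == y, b y == x, b' x == y | b' y == x]))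
    [set: 'I_(4*n)].

(* the involution of the sphere acts on boundary points by x |-> x + 2n mod 4n *)
Definition negC (n : nat) (C : {set 'I_(4*n)}) := rotset (2*n) C.

Definition c0 (n : nat) (b b' : 'I_(4*n) -> 'I_(4*n)) : nat :=
  #|[set C in circles b b' | negC C == C]|.
Definition cd (n : nat) (b b' : 'I_(4*n) -> 'I_(4*n)) : nat :=
  #|[set C in circles b b' | negC C != C]| %/ 2.

(* Main.v *)
Require Import Defs.
From HB Require Import structures.
From mathcomp Require Import all_boot all_order all_algebra.
From mathcomp Require Import all_fingroup zify ring.
Import Order.TTheory GRing.Theory Num.Theory.

(* The map [nextb P] is a permutation [sP] of the labels whose cycles are the
   blocks of [P], and the circles of [betaB P] and [betaB Q] correspond to the
   cycles of [sQ^-1 sP].  As [P] and [Q] are non-crossing, the hypermap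
   [(sP, sQ)] has genus 0, so that Euler's formula reads
     cyc sP + cyc sQ + cyc (sQ^-1 sP) = 2n + 2 #blocks(P v Q).
   All this is invariant under negation, and the induced permutations of the
   labels modulo [n] are again non-crossing, hence satisfy the same formula with
   [n] in place of [2n].  Passing to the quotient merges the two classes of each
   pair {K, -K} with K <> -K and preserves the number of zero classes, so the
   difference of the two formulas is the relation between the numbers of
   non-zero classes. *)

Set Implicit Arguments.
Unset Strict Implicit.
Unset Printing Implicit Defensive.

(** * Counting equivalence classes *)

Lemma leq_card_imset_factor (T A B : finType) (g : T -> A) (h : T -> B)
    (D : {set T}) :
  {in D &, forall x y, g x = g y -> h x = h y} -> #|h @: D| <= #|g @: D|.
Proof.
move=> gh; have [->|[x0 Dx0]] := set_0Vmem D; first by rewrite imset0 cards0.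
(* On [D] the map [h] factors through [g], and [k] is the factor. The default [x0] is irrelevant at
   points of [g @: D], the only ones considered. *)
pose k a := h (odflt x0 [pick x in D | g x == a]).
apply: leq_trans (leq_imset_card k _); apply: subset_leq_card.
apply/subsetP=> _ /imsetP[x Dx ->]; apply/imsetP; exists (g x).
  exact: imset_f.
rewrite /k; case: pickP => [y /andP[Dy /eqP gy]|/(_ x)] /=.
  exact: gh.
by rewrite Dx eqxx.
Qed.

Lemma eq_card_imset_factor (T A B : finType) (g : T -> A) (h : T -> B)
    (D : {set T}) :
  {in D &, forall x y, g x = g y <-> h x = h y} -> #|h @: D| = #|g @: D|.
Proof.
move=> gh; apply/eqP.
by rewrite eqn_leq !leq_card_imset_factor // => x y Dx Dy /(gh _ _ Dx Dy).
Qed.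

Notation eqclasses R := (equivalence_partition R setT).
Definition eqclass (T : finType) (R : rel T) (x : T) := [set y in setT | R x y].

Lemma eqclassesE (T : finType) (R : rel T) : eqclasses R = eqclass R @: setT.
Proof. by []. Qed.

Lemma eq_classes (T : finType) (R R' : rel T) : R =2 R' -> eqclasses R = eqclasses R'.
Proof.
by move=> eqR; apply: eq_imset => x; apply/setP=> y; rewrite !inE eqR.
Qed.

Section Equivalences.

Variables (T : finType) (R : rel T).
Hypotheses (Rr : reflexive R) (Rs : symmetric R) (Rt : transitive R).

Lemma eq_eqclassP (x y : T) : eqclass R x = eqclass R y <-> R x y.
Proof.
split=> [/setP/(_ y)|Rxy]; first by rewrite !inE Rr /=.
apply/setP=> z; rewrite !inE /=.
by apply/idP/idP; apply: Rt => //; rewrite Rs.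
Qed.

Lemma leq_card_classes (R' : rel T) :
    reflexive R' -> symmetric R' -> transitive R' -> subrel R R' ->
  #|eqclasses R'| <= #|eqclasses R|.
Proof.
move=> R'r R's R't sub; apply: leq_card_imset_factor => x y _ _ /eq_eqclassP.
move=> /sub R'xy; apply/setP=> z; rewrite !inE /=.
by apply/idP/idP; apply: R't => //; rewrite R's.
Qed.

(** The smallest equivalence containing [R] and the pair [(x, y)]. Since [R] is already an
    equivalence, one crossing between the two classes is enough and no closure has to be taken. *)
Definition glue (x y : T) : rel T :=
  fun u v => [|| R u v, R u x && R y v | R u y && R x v].

Lemma glue_refl x y : reflexive (glue x y).
Proof. by move=> u; rewrite /glue Rr. Qed.

Lemma glue_sym x y : symmetric (glue x y).
Proof.
move=> u v; rewrite /glue (Rs u v) (Rs u x) (Rs y v) (Rs u y) (Rs x v).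
by rewrite (andbC (R x u)) (andbC (R y u)) [_ && _ || _]orbC.
Qed.

Lemma glue_trans x y : transitive (glue x y).
Proof.
move=> v u w; rewrite /glue.
have tr a b c : R a b -> R b c -> R a c by move=> h; apply: Rt.
case/or3P=> [uv|/andP[ux yv]|/andP[uy xv]];
  case/or3P=> [vw|/andP[vx yw]|/andP[vy xw]].
- by rewrite (tr _ _ _ uv vw).
- by rewrite (tr _ _ _ uv vx) yw orbT.
- by rewrite (tr _ _ _ uv vy) xw !orbT.
- by rewrite ux (tr _ _ _ yv vw) orbT.
- by rewrite ux yw orbT.
- by rewrite (tr _ _ _ ux xw).
- by rewrite uy (tr _ _ _ xv vw) !orbT.
- by rewrite (tr _ _ _ uy yw).
- by rewrite uy xw !orbT.
Qed.

Lemma card_classes_glue x y :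
  #|eqclasses R| <= #|eqclasses (glue x y)| + ~~ R x y.
Proof.
have [Rxy|nRxy] := boolP (R x y).
  rewrite addn0; apply: leq_card_imset_factor => u v _ _.
  move/setP/(_ v); rewrite !inE glue_refl /= => /or3P e; apply/eq_eqclassP.
  case: e => [//|/andP[ux yv]|/andP[uy xv]].
    exact: Rt ux (Rt Rxy yv).
  by apply: Rt uy (Rt _ xv); rewrite Rs.
(* Away from the class of [y], gluing identifies nothing new, so the class of [y] is the only one
   that can be lost. *)
pose D := [set u | ~~ R u y].
have -> : eqclasses R = eqclass R y |: eqclass R @: D.
  apply/setP=> K; rewrite !inE; apply/imsetP/orP=> [[u _ ->]|].
    have [Ruy|nRuy] := boolP (R u y); [left|right].
      by apply/eqP/eq_eqclassP.
    by apply: imset_f; rewrite inE.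
  by case=> [/eqP->|/imsetP[u _ ->]]; [exists y | exists u].
rewrite cardsU1 addnC leq_add //; last by case: (_ \notin _).
apply: (@leq_trans #|eqclass (glue x y) @: D|); last first.
  by apply: subset_leq_card; apply: imsetS; apply: subsetT.
apply: leq_card_imset_factor => u v; rewrite !inE => nuy nvy.
move/setP/(_ v); rewrite !inE glue_refl /= => /or3P e; apply/eq_eqclassP.
case: e => [//|/andP[_ yv]|/andP[uy _]].
  by rewrite Rs yv in nvy.
by rewrite uy in nuy.
Qed.

End Equivalences.

(* A class is fixed by [F] or swapped with another one; both situations are
   merged into a single class downstairs. *)
Lemma card_classes_quotient (T U : finType) (R : rel T) (R' : rel U)
    (F : T -> T) (q : T -> U) :
    reflexive R -> symmetric R -> transitive R ->
    reflexive R' -> symmetric R' -> transitive R' ->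
    (forall x y, R (F x) (F y) = R x y) -> involutive F ->
    (forall u, exists x, q x = u) ->
    (forall x y, R' (q x) (q y) = R x y || R x (F y)) ->
  #|eqclasses R| =
  #|eqclasses R'| + #|[set K in eqclasses R | [set F x | x in K] != K]| %/ 2.
Proof.
move=> Rr Rs Rt R'r R's R't RF FF qsurj R'q.
have clF x : [set F y | y in eqclass R x] = eqclass R (F x).
  apply/setP=> y; rewrite !inE; apply/imsetP/idP => [[z]|Rxy].
    by rewrite !inE /= => Rxz ->; rewrite RF.
  by exists (F y); rewrite ?FF // !inE -(RF x) FF.
have RxF x y : R (F x) y = R x (F y) by rewrite -RF FF.
pose g := eqclass R; pose h x := eqclass R' (q x).
have gE x y : g x = g y <-> R x y by apply: eq_eqclassP.
have hE x y : h x = h y <-> R x y || R x (F y) by rewrite -R'q; apply: eq_eqclassP.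
(* [D] is the union of the classes moved by [F]. Classes outside [D] correspond one to one to their
   images below; those inside [D] are shown to correspond two to one. *)
pose D := [set x | ~~ R x (F x)].
have sat x y : R x y -> (x \in D) = (y \in D).
  rewrite !inE => Rxy; congr (~~ _); apply/idP/idP => H.
    by apply: Rt (Rt _ _ _ H _); rewrite ?RF // Rs.
  by apply: Rt (Rt _ _ _ H _) => //; rewrite RF Rs.
have satF x : (F x \in D) = (x \in D) by rewrite !inE FF Rs.
have sath x y : h x = h y -> (x \in D) = (y \in D).
  by case/hE/orP=> /sat // ->; rewrite satF.
have split (A : finType) (k : T -> A) :
    (forall x y, k x = k y -> (x \in D) = (y \in D)) ->
    #|k @: setT| = #|k @: D| + #|k @: (~: D)|.
  move=> satk; rewrite -cardsUI -imsetU setUCr.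
  suff -> : (k @: D) :&: (k @: (~: D)) = set0 by rewrite cards0 addn0.
  apply/setP=> a; rewrite !inE; apply/negP=> /andP[/imsetP[x Dx ->]].
  by case/imsetP=> y; rewrite inE => nDy /satk e; rewrite -e Dx in nDy.
have -> : [set K in eqclasses R | [set F x | x in K] != K] = g @: D.
  apply/setP=> K; rewrite !inE; apply/andP/imsetP => [[/imsetP[x _ ->]]|[x Dx ->]].
    rewrite clF => neq; exists x => //; rewrite inE; apply: contra neq => H.
    by apply/eqP/gE; rewrite Rs.
  split; first exact: imset_f.
  rewrite clF; apply/eqP=> /gE; rewrite RxF => H.
  by move: Dx; rewrite inE -RxF Rs -RxF; move: H; rewrite RxF => ->.
have -> : eqclasses R = g @: setT by [].
have -> : #|eqclasses R'| = #|h @: setT|.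
  apply: eq_card => K; apply/imsetP/imsetP=> [[u _ ->]|[x _ ->]].
    by have [x <-] := qsurj u; exists x.
  by exists (q x).
rewrite (split _ g) => [|x y /gE/sat//]; rewrite (split _ h) //.
have -> : #|g @: (~: D)| = #|h @: (~: D)|.
  apply/esym/eq_card_imset_factor => x y; rewrite !inE !negbK => xF yF.
  rewrite gE hE; split=> [->//|/orP[//|H]]; apply: Rt H _; by rewrite Rs.
suff -> : #|g @: D| = (2 * #|h @: D|)%N by rewrite mulKn //; lia.
(* [k] sends a class to the class below it. Its fibre over [h x], for [x] in [D], is the two-element
   set of [g x] and [g (F x)]. *)
pose k (K : {set T}) := [set v | [exists u in K, R' (q u) v]].
have kg x : k (g x) = h x.
  apply/setP=> v; rewrite !inE; apply/existsP/idP => [[u]|H].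
    rewrite !inE /= => /andP[Rxu]; apply: R't; by rewrite R'q Rxu.
  by exists x; rewrite !inE Rr.
rewrite -sum1_card (partition_big k (mem (h @: D))) /=; last first.
  by move=> _ /imsetP[x Dx ->]; rewrite kg imset_f.
rewrite mulnC -sum_nat_const; apply: eq_bigr => _ /imsetP[x Dx ->].
rewrite sum1_card (_ : #|_| = #|[set g x; g (F x)]|).
  rewrite cards2; move: Dx; rewrite inE; case: eqP => // /gE -> //.
apply: eq_card => K; rewrite !inE; apply/andP/orP.
  case=> /imsetP[y Dy ->]; rewrite kg => /eqP/hE/orP[H|H]; [left|right].
    exact/eqP/gE.
  exact/eqP/gE.
by case=> /eqP->; rewrite imset_f ?kg ?satF // ?eqxx; split=> //; apply/eqP/hE;
   rewrite RxF Rr orbT.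
Qed.

(** * The genus of a pair of permutations *)

Lemma mem_porbit_perm (T : finType) (s : {perm T}) x : s x \in porbit s x.
Proof. by rewrite -{1}(expg1 s) mem_porbit. Qed.

Lemma porbit_ind (T : finType) (s : {perm T}) (P : T -> Prop) x y :
  y \in porbit s x -> P x -> (forall z, P z -> P (s z)) -> P y.
Proof.
case/porbitP=> i -> Px Ps; elim: i => [|i IH]; first by rewrite expg0 perm1.
by rewrite expgSr permM; apply: Ps.
Qed.

Definition orel (T : finType) (s : {perm T}) : rel T := fun x y => y \in porbit s x.

Lemma orel_refl (T : finType) (s : {perm T}) : reflexive (orel s).
Proof. by move=> x; apply: porbit_id. Qed.

Lemma orel_sym (T : finType) (s : {perm T}) : symmetric (orel s).
Proof. by move=> x y; rewrite /orel porbit_sym. Qed.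

Lemma orel_trans (T : finType) (s : {perm T}) : transitive (orel s).
Proof.
move=> y x z; rewrite /orel -!eq_porbit_mem => /eqP<- /eqP->.
by rewrite eq_porbit_mem porbit_id.
Qed.

Lemma porbitsE (T : finType) (s : {perm T}) : porbits s = eqclasses (orel s).
Proof.
have E x : eqclass (orel s) x = porbit s x by apply/setP=> y; rewrite !inE.
by apply/setP=> K; rewrite eqclassesE;
   apply/imsetP/imsetP=> -[x _ ->]; exists x; rewrite ?E.
Qed.

Definition cyc (T : finType) (s : {perm T}) := #|porbits s|.

Lemma cyc_mul_tperm (T : finType) (s : {perm T}) x y :
  cyc (tperm x y * s)%g + (x \notin porbit s y).*2 = cyc s + (x != y).
Proof. exact: porbits_mul_tperm. Qed.

Lemma cycV (T : finType) (s : {perm T}) : cyc s^-1%g = cyc s.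
Proof. by rewrite /cyc porbitsV. Qed.

Lemma cyc1 (T : finType) : cyc (1 : {perm T})%g = #|T|.
Proof.
rewrite /cyc.
rewrite card_imset // => x y exy; move: (porbit_id 1%g x); rewrite exy.
by case/porbitP=> i; rewrite expg1n perm1.
Qed.

Section Genus.

Variable T : finType.
Implicit Types s t : {perm T}.

(** The orbit relation of the group generated by [s] and [t]; its classes are the connected
    components of the hypermap. *)
Definition jrel s t : rel T := connect (fun x y => orel s x y || orel t x y).
Definition norb s t := #|eqclasses (jrel s t)|.

Lemma jrel_refl s t : reflexive (jrel s t).
Proof. by move=> x; apply: connect0. Qed.

Lemma jrel_trans s t : transitive (jrel s t).
Proof. by move=> y x z; apply: connect_trans. Qed.

Lemma jrel_sym s t : symmetric (jrel s t).
Proof. by apply: sym_connect_sym => x y; rewrite !(orel_sym _ x). Qed.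

Lemma jrel_orbl s t x y : orel s x y -> jrel s t x y.
Proof. by move=> h; apply: connect1; rewrite h. Qed.

Lemma jrel_orbr s t x y : orel t x y -> jrel s t x y.
Proof. by move=> h; apply: connect1; rewrite h orbT. Qed.

Lemma jrel_ind s t (P : T -> Prop) x y :
    jrel s t x y -> P x ->
    (forall z, P z -> P (s z)) -> (forall z, P z -> P (t z)) -> P y.
Proof.
move=> /connectP[p pp ->] Px Ps Pt; elim: p x pp Px => //= z p IH x.
case/andP=> xz pp Px; apply: IH pp _.
by case/orP: xz => h; apply: (porbit_ind (P := P) h).
Qed.

Lemma jrel_min s t (R : rel T) :
    reflexive R -> transitive R ->
    (forall x, R x (s x)) -> (forall x, R x (t x)) ->
  subrel (jrel s t) R.
Proof.
move=> Rr Rt hs ht x y h.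
by apply: (jrel_ind (P := fun w => R x w) h) => // z xz; apply: (Rt) xz _.
Qed.

Lemma norbC s t : norb s t = norb t s.
Proof.
by rewrite /norb (@eq_classes _ _ (jrel t s)) // => x y;
   apply: eq_connect => u v; rewrite orbC.
Qed.

Lemma orelE s : orel s =2 jrel s s.
Proof.
move=> x y; apply/idP/idP; first exact: jrel_orbl.
apply: jrel_min => //; first exact: orel_refl; first exact: orel_trans;
  exact: mem_porbit_perm.
Qed.

Lemma norb1 s : norb s 1%g = cyc s.
Proof.
rewrite /cyc porbitsE /norb (@eq_classes _ _ (orel s)) // => x y.
apply/idP/idP; last exact: jrel_orbl.
apply: jrel_min; [exact: orel_refl|exact: orel_trans|exact: mem_porbit_perm|].
by move=> z; rewrite perm1 orel_refl.
Qed.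

Lemma norb_diag s : norb s s = cyc s.
Proof. by rewrite /cyc porbitsE /norb (eq_classes (orelE s)). Qed.

(** Vertices, hyperedges and faces of the hypermap: the part of Euler's formula that counts
    cycles. *)
Definition ncyc s t := cyc s + cyc t + cyc (t * s^-1)%g.

(** Swapping [s] and [t] inverts the quotient permutation, which keeps its cycles. This lets either
    permutation be simplified in turn. *)
Lemma ncycC s t : ncyc s t = ncyc t s.
Proof.
rewrite /ncyc (addnC (cyc s)) -(cycV (t * s^-1)%g).
by rewrite invMg invgK.
Qed.

Lemma jrel_quot s t x y : orel (t * s^-1)%g x y -> jrel s t x y.
Proof.
move=> h; apply: (porbit_ind (P := fun w => jrel s t x w) h) => [|z xz].
  exact: jrel_refl.
apply: jrel_trans xz _; apply: (@jrel_trans _ _ (t z)).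
  exact/jrel_orbr/mem_porbit_perm.
rewrite permM jrel_sym; apply: jrel_orbl.
by rewrite -{2}(permKV s (t z)); apply: mem_porbit_perm.
Qed.

(* The genus [(#|T| + 2 norb - ncyc) / 2] of the hypermap [(s, t)] does not
   decrease when two cycles of [t] are merged. *)
Lemma genus_merge s t x y : x \notin porbit t y ->
  2 * norb s t + ncyc s (tperm x y * t)%g <=
  2 * norb s (tperm x y * t)%g + ncyc s t.
Proof.
move=> nxy; have neq : x != y by apply: contraNneq nxy => ->; apply: porbit_id.
have c1 : cyc (tperm x y * t * s^-1)%g + (x \notin porbit (t * s^-1)%g y).*2
    = cyc (t * s^-1)%g + 1 by rewrite -mulgA cyc_mul_tperm neq.
have := cyc_mul_tperm t x y; rewrite nxy neq /ncyc.
(* Every step of the new pair is a step of the old one, up to gluing the orbits of [x] and [y]. *)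
have le1 : norb s t <= norb s (tperm x y * t)%g + ~~ jrel s t x y.
  have Er := @jrel_refl s t; have Es := @jrel_sym s t.
  have Et := @jrel_trans s t.
  apply: leq_trans (card_classes_glue Er Es Et x y) _; rewrite leq_add2r.
  apply: leq_card_classes; try exact: jrel_refl; try exact: jrel_sym;
    try exact: jrel_trans; try exact: glue_refl; try exact: glue_sym;
    try exact: glue_trans.
  have hs z : jrel s t z (s z) by apply/jrel_orbl/mem_porbit_perm.
  have ht z : jrel s t z (t z) by apply/jrel_orbr/mem_porbit_perm.
  apply: jrel_min; [exact: glue_refl|exact: glue_trans| |].
    by move=> z; rewrite /glue hs.
  move=> z; rewrite /glue permM; case: tpermP => [->|->|_ _].
  - by rewrite Er ht /= orbT.
  - by rewrite Er ht /= !orbT.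
  - by rewrite ht.
(* If a component is lost, then [x] and [y] also lie in distinct faces. These merge too, so [ncyc]
   drops by 2 and compensates. *)
have le2 : (~~ jrel s t x y : nat) <= (x \notin porbit (t * s^-1)%g y).
  have [] // := boolP (jrel s t x y) => nj; rewrite lt0b.
  apply: contra nj => h; apply: jrel_quot; by rewrite orel_sym.
by move: c1 le1 le2; case: (jrel _ _ _ _); case: (x \notin _) => /=; lia.
Qed.

(** Splitting fixed points off [t] one by one does not increase the genus, and for [t = 1] the two
    sides are equal. *)
Lemma genus_ge0 s t : ncyc s t <= #|T| + 2 * norb s t.
Proof.
have [k] := ubnP (#|T| - cyc t); elim: k t => // k IH t ltk.
have [/forallP t1|] := boolP [forall x, t x == x].
  have -> : t = 1%g by apply/permP=> x; rewrite perm1; apply/eqP.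
  rewrite /ncyc cyc1 mul1g cycV norb1; lia.
rewrite negb_forall => /existsP[x tx].
(* As [t y = x], the permutation [t0] fixes [x], so [t] arises from [t0] by merging two cycles. *)
pose y := (t^-1)%g x; pose t0 := (tperm x y * t)%g.
have tE : t = (tperm x y * t0)%g by rewrite mulgA tperm2 mul1g.
have neq : x != y by apply: contraNneq tx => e; rewrite {1}e permKV.
have xy : x \in porbit t y.
  by rewrite -{1}(permKV t x) mem_porbit_perm.
have := cyc_mul_tperm t x y; rewrite xy neq -/t0 addn0 => c1.
have := cyc_mul_tperm t0 x y; rewrite neq -tE => c2.
have nx : x \notin porbit t0 y by move: c2; case: (x \in _) => //=; lia.
have le : cyc t0 <= #|T| by apply: leq_imset_card.
have := @genus_merge s t0 x y nx; rewrite -tE.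
have : ncyc s t0 <= #|T| + 2 * norb s t0 by apply: IH; lia.
lia.
Qed.

Lemma genus_diag s : ncyc s s = #|T| + 2 * norb s s.
Proof.
by rewrite /ncyc mulgV cyc1 norb_diag; lia.
Qed.

End Genus.

(** * Non-crossing permutations of a cycle *)

(* [y] lies on the open anticlockwise arc from [x] to [z]; for [x = z] this arc
   is the whole circle without [x]. *)
Definition btw (x y z : nat) : bool :=
  ((x < y) && (y < z)) || ((z <= x) && ((x < y) || (y < z))).

(* The cycles of such a permutation are the blocks of a non-crossing partition,
   each traversed anticlockwise. *)
Definition ncperm (m : nat) (s : {perm 'I_m}) : Prop :=
  forall x y : 'I_m, btw x y (s x) -> btw x (s y) (s x).

Lemma btw_total (x y z : nat) : y != z -> btw x y z || btw x z y.
Proof. rewrite /btw; lia. Qed.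

(** Otherwise, walking from each label to the next, all labels would lie in the cycle of 0. Two
    cycles that meet at neighbouring labels can be merged without a crossing. *)
Lemma neighbours_in_distinct_cycles m (s : {perm 'I_m}) : 1 < cyc s ->
  exists i j : 'I_m, j = i.+1 :> nat /\ j \notin porbit s i.
Proof.
move=> c1; have [|all0] := boolP [exists i : 'I_m, exists j : 'I_m,
    (j == i.+1 :> nat) && (j \notin porbit s i)].
  by case/existsP=> i /existsP[j /andP[/eqP e h]]; exists i, j.
have m_gt0 : 0 < m.
  case: m s c1 {all0} => // s; rewrite ltnNge => /negP[].
  by apply: leq_trans (leq_imset_card _ _) _; rewrite card_ord.
pose o0 := Ordinal m_gt0.
have conn k (lt : k < m) : Ordinal lt \in porbit s o0.
  elim: k lt => [|k IH] lt.
    by rewrite (_ : Ordinal _ = o0) ?porbit_id //; apply: val_inj.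
  have lt' : k < m by apply: ltnW.
  have := IH lt'; rewrite -eq_porbit_mem => /eqP <-.
  apply: contraNT all0 => h; apply/existsP; exists (Ordinal lt').
  by apply/existsP; exists (Ordinal lt); rewrite eqxx.
move: c1; rewrite ltnNge => /negP[]; rewrite -(cards1 (porbit s o0)).
apply: subset_leq_card; apply/subsetP=> _ /imsetP[x _ ->]; rewrite inE.
by rewrite eq_porbit_mem; case: x => x lt; apply: conn.
Qed.

Lemma ncperm_merge m (s : {perm 'I_m}) : ncperm s -> 1 < cyc s ->
  exists x y, x \notin porbit s y /\ ncperm (tperm x y * s)%g.
Proof.
move=> nc /neighbours_in_distinct_cycles[i [j [ji nij]]].
(* With this [b], the merged permutation sends [i] to its neighbour [j] and [b] to [s i]: the cycle
   of [j] is inserted right after [i]. *)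
pose b := (s^-1)%g j; have sb : s b = j by rewrite permKV.
have nib : i \notin porbit s b.
  apply: contra nij => ib; have := mem_porbit_perm s b; rewrite sb.
  by rewrite -!eq_porbit_mem in ib * => /eqP->; rewrite eq_sym.
have neq : i != b by apply: contraNneq nib => ->; apply: porbit_id.
exists i, b; split=> // x y; rewrite !permM.
have nsi : s i != j by apply: contraNneq nij => <-; apply: mem_porbit_perm.
have neqv : (i : nat) != b by [].
have nsiv : (s i : nat) != j by [].
(* The arc from [i] to [s i] contains [j], hence by non-crossing the whole cycle of [j], and in
   particular [b]. *)
have bi : btw i b (s i).
  have jbt : btw i j (s i) by rewrite /btw ji; lia.
  apply: (porbit_ind (s := s) (P := fun z : 'I_m => is_true (btw i z (s i))) _ jbt).
    by rewrite porbit_sym -sb mem_porbit_perm.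
  by move=> z; apply: nc.
have lti := ltn_ord i; have ltj := ltn_ord j; have lty := ltn_ord y.
have ltx := ltn_ord x; have ltb := ltn_ord b; have ltsi := ltn_ord (s i).
have ltsy := ltn_ord (s y); have ltsx := ltn_ord (s x).
(* The new arc from [i] to [j] is empty. The new arc from [b] to [s i] lies in the old arcs leaving
   [i] and [b]. The other arcs are unchanged, and only the images of [i] and [b] need care. *)
case: (tpermP i b x) => [->|->|xi xb].
- by rewrite sb /btw ji; lia.
- move=> yb; have yi : (y : nat) != i by move: yb bi; rewrite /btw; lia.
  have yb' : (y : nat) != b by move: yb; rewrite /btw; lia.
  rewrite tpermD; try by rewrite eq_sym.
  have h1 : btw i y (s i) by move: yb bi; rewrite /btw; lia.
  have h2 : btw b y (s b) by rewrite sb; move: yb bi; rewrite /btw; lia.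
  by have := nc _ _ h1; have := nc _ _ h2; rewrite sb; move: bi; rewrite /btw; lia.
have xiv : (x : nat) != i by apply/eqP => /val_inj.
have xbv : (s x : nat) != j.
  by rewrite -sb; apply/eqP=> /val_inj/perm_inj.
case: (tpermP i b y) => [->|->|yi yb].
- by move=> h; have := nc _ _ h; rewrite sb; move: h; rewrite /btw; lia.
- move/nc; rewrite sb => h; apply: nc; move: h; rewrite /btw; lia.
exact: nc.
Qed.

(** A label inside the arc from [x] to [s x] would keep its whole cycle there, but that cycle
    contains [x]. So [s] sends each label to its cyclic successor. *)
Lemma ncperm_cycle_btw m (s : {perm 'I_m}) : ncperm s -> cyc s <= 1 ->
  forall x y : 'I_m, ~~ btw x y (s x).
Proof.
move=> nc c1 x y; apply/negP=> xy.
have yx : x \in porbit s y.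
  rewrite -eq_porbit_mem; apply/eqP; move/card_le1P: c1.
  move/(_ (porbit s x) (imset_f _ _) (porbit s y)).
  by rewrite imset_f // => /(_ isT)/esym/eqP.
suff : btw x x (s x) by rewrite /btw; lia.
apply: (porbit_ind (s := s) (P := fun z : 'I_m => is_true (btw x z (s x))) yx xy).
by move=> z; apply: nc.
Qed.

Lemma ncperm_cycle_uniq m (s t : {perm 'I_m}) :
  ncperm s -> cyc s <= 1 -> ncperm t -> cyc t <= 1 -> s = t.
Proof.
move=> ncs cs nct ct; apply/permP=> x; apply/eqP; apply: contraT => neq.
have := @btw_total x (s x) (t x) neq.
by rewrite (negbTE (ncperm_cycle_btw nct ct _ _)) (negbTE (ncperm_cycle_btw ncs cs _ _)).
Qed.

(** Merging the cycles of [t] down to one never lowers the genus, so genus 0 for the cyclic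
    permutation forces genus 0 for [t]. *)
Lemma ncperm_genus0_from_cycle m (s t : {perm 'I_m}) :
    (forall u, ncperm u -> cyc u <= 1 -> #|'I_m| + 2 * norb s u <= ncyc s u) ->
  ncperm t -> #|'I_m| + 2 * norb s t <= ncyc s t.
Proof.
move=> base; have [k] := ubnP (cyc t); elim: k t => // k IH t ltk nct.
have [c1|c1] := leqP (cyc t) 1; first exact: base.
have [x [y [nxy nct']]] := ncperm_merge nct c1.
have := cyc_mul_tperm t x y; rewrite nxy => ct'.
have neq : x != y by apply: contraNneq nxy => ->; apply: porbit_id.
have := genus_merge s nxy.
have : #|'I_m| + 2 * norb s (tperm x y * t)%g <= ncyc s (tperm x y * t)%g.
  by apply: IH => //; move: ct'; rewrite neq; lia.
lia.
Qed.

Lemma ncperm_genus0 m (s t : {perm 'I_m}) : ncperm s -> ncperm t ->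
  ncyc s t = m + 2 * norb s t.
Proof.
move=> ncs nct; apply/eqP; rewrite eqn_leq.
have := genus_ge0 s t; rewrite card_ord => -> /=; rewrite -[X in X + _]card_ord.
(* Both permutations are reduced in turn to single cycles. These coincide by uniqueness, and a pair
   of equal permutations has genus 0. *)
apply: ncperm_genus0_from_cycle nct => u ncu cu.
rewrite norbC ncycC; apply: ncperm_genus0_from_cycle ncs => v ncv cv.
by rewrite (ncperm_cycle_uniq ncu cu ncv cv) genus_diag.
Qed.

(** * Labels modulo n *)

Section Quotient.

Variable n : nat.
Notation f := (@Defs.rot (2 * n) n).

Lemma rot_halfE (m k : nat) (x : 'I_m) : m = 2 * k ->
  Defs.rot k x = (if x < k then x + k else x - k) :> nat.
Proof.
move=> mk; have ltx := ltn_ord x; rewrite /=.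
case: ltnP => h; first by rewrite modn_small //; lia.
have -> : x + k = (x - k) + m by lia.
by rewrite modnDr modn_small //; lia.
Qed.

Lemma rot_half_inv (m k : nat) : m = 2 * k -> involutive (@Defs.rot m k).
Proof.
move=> mk x; apply: ord_inj; rewrite !(rot_halfE _ mk).
by have ltx := ltn_ord x; case: (ltnP x k) => h; case: ltnP; lia.
Qed.

Let fE (x : 'I_(2 * n)) : f x = (if x < n then x + n else x - n) :> nat.
Proof. exact: rot_halfE. Qed.

Let fK : involutive f.
Proof. exact: rot_half_inv. Qed.

Lemma modn_ltn_proof (x : 'I_(2 * n)) : x %% n < n.
Proof. by rewrite ltn_pmod //; have := ltn_ord x; lia. Qed.

Definition qmod (x : 'I_(2 * n)) : 'I_n := Ordinal (modn_ltn_proof x).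
Definition qlift (y : 'I_n) : 'I_(2 * n) := widen_ord (leq_pmull n (isT : 0 < 2)) y.

Lemma qmodE x : qmod x = (if x < n then x : nat else x - n) :> nat.
Proof.
rewrite /=; have ltx := ltn_ord x; case: ltnP => h; first by rewrite modn_small.
have -> : nat_of_ord x = (x - n) + n by lia.
by rewrite modnDr modn_small; lia.
Qed.

Lemma qliftK : cancel qlift qmod.
Proof. by move=> y; apply: ord_inj; rewrite qmodE /= ltn_ord. Qed.

Lemma qmod_rot x : qmod (f x) = qmod x.
Proof.
apply: ord_inj; rewrite !qmodE fE; have ltx := ltn_ord x.
by case: (ltnP x n) => h; case: ltnP; lia.
Qed.

Lemma qmod_eq x y : qmod x = qmod y -> y = x \/ y = f x.
Proof.
move/(congr1 (@nat_of_ord n)); rewrite !qmodE => e.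
have := ltn_ord x; have := ltn_ord y.
have [|neq] := eqVneq y x; first by left.
move=> lty ltx; right; apply: ord_inj; rewrite fE; move/eqP: neq => neq.
have {}neq : (y : nat) <> x by move/val_inj.
by move: e; case: (ltnP x n) => hx; case: (ltnP y n) => hy; lia.
Qed.

Section QuotientPerm.

Variable s : {perm 'I_(2 * n)}.
Hypothesis sf : forall x, s (f x) = f (s x).

Lemma qperm_inj : injective (fun y => qmod (s (qlift y))).
Proof.
move=> y z /qmod_eq; rewrite -sf => -[] /perm_inj e.
  by rewrite -(qliftK y) -(qliftK z) e.
by rewrite -(qliftK y) -(qliftK z) e qmod_rot.
Qed.

Definition qperm : {perm 'I_n} := perm qperm_inj.

Lemma qpermE x : qperm (qmod x) = qmod (s x).
Proof.
rewrite permE; have [->//|->] := @qmod_eq x (qlift (qmod x)) (esym (qliftK _)).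
by rewrite sf qmod_rot.
Qed.

(* When the arc from [x] to [s x] is longer than half of the circle, it contains
   [- x]; the arcs leaving [x] and [- x] then intersect in two opposite arcs
   mapped onto the arc from [qmod x] to [qmod (s x)]. *)
Lemma ncperm_qperm : ncperm s -> ncperm qperm.
Proof.
move=> nc x y.
have lx := ltn_ord x; have ly := ltn_ord y.
pose X := qlift x; pose Y := qlift y.
rewrite -[x](qliftK) -[y](qliftK) !qpermE -/X -/Y !qmodE.
have XE : X = x :> nat by []. have YE : Y = y :> nat by [].
have fX : f X = x + n :> nat by rewrite fE XE lx.
have fY : f Y = y + n :> nat by rewrite fE YE ly.
have h1 := @nc X Y; have h2 := @nc X (f Y).
have h3 := @nc (f X) Y; have h4 := @nc (f X) (f Y); have h5 := @nc X (f X).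
rewrite !sf !fE XE YE lx ly in h1 h2 h3 h4 h5 *.
have := ltn_ord (s X); have := ltn_ord (s Y).
move: (nat_of_ord (s X)) (nat_of_ord (s Y)) h1 h2 h3 h4 h5 => u v.
(* In case [A] the arc is at most half of the circle, and the lift of [y] on it is [Y] or [f Y]
   according to whether [x < y]. In case [B] the arcs from [X] and from [f X] are used together. *)
have [A|B] := boolP ((x < u) && (u <= x + n)); have [xy|xy] := ltnP x y.
- move=> h1 _ _ _ _ lv lu g.
  have {}g : btw x y u by move: g; rewrite /btw; case: ifP; lia.
  by move: (h1 g); rewrite /btw; case: ifP; case: ifP; lia.
- move=> _ h2 _ _ _ lv lu g.
  have {}g : btw x (y + n) u by move: g; rewrite /btw; case: ifP; lia.
  by move: (h2 g); rewrite /btw; case: ifP; case: ifP; lia.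
- move=> h1 _ h3 _ h5 lv lu g.
  have {}h5 : btw x (if u < n then u + n else u - n) u.
    by apply: h5; rewrite /btw; lia.
  have g1 : btw x y u by move: g h5; rewrite /btw; case: ifP; lia.
  have g3 : btw (x + n) y (if u < n then u + n else u - n).
    by move: g h5; rewrite /btw; case: ifP; lia.
  by move: (h1 g1) (h3 g3) h5; rewrite /btw; do 2?case: ifP; lia.
move=> _ h2 _ h4 h5 lv lu g.
have {}h5 : btw x (if u < n then u + n else u - n) u.
  by apply: h5; rewrite /btw; lia.
have g2 : btw x (y + n) u by move: g h5; rewrite /btw; case: ifP; lia.
have g4 : btw (x + n) (y + n) (if u < n then u + n else u - n).
  by move: g h5; rewrite /btw; case: ifP; lia.
by move: (h2 g2) (h4 g4) h5; rewrite /btw; do 2?case: ifP; lia.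
Qed.

End QuotientPerm.

End Quotient.

(** * Counting orbits modulo negation *)

Section QuotientCount.

Variables (n : nat) (s t : {perm 'I_(2 * n)}) (s' t' : {perm 'I_n}).
Notation f := (@Defs.rot (2 * n) n).
Hypotheses (sf : forall x, s (f x) = f (s x)) (tf : forall x, t (f x) = f (t x)).
Hypotheses (sq : forall x, qmod (s x) = s' (qmod x)).
Hypotheses (tq : forall x, qmod (t x) = t' (qmod x)).

Let fK : involutive f.
Proof. exact: rot_half_inv. Qed.

Lemma jrel_rot x y : jrel s t (f x) (f y) = jrel s t x y.
Proof.
have half u v : jrel s t u v -> jrel s t (f u) (f v).
  move=> h; apply: (jrel_ind (P := fun w => jrel s t (f u) (f w)) h).
  - exact: jrel_refl.
  - move=> z uz; apply: jrel_trans uz _; rewrite -sf.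
    exact/jrel_orbl/mem_porbit_perm.
  - move=> z uz; apply: jrel_trans uz _; rewrite -tf.
    exact/jrel_orbr/mem_porbit_perm.
by apply/idP/idP=> /half; rewrite ?fK.
Qed.

(** A path modulo [n] lifts step by step because [s] and [t] commute with negation; its endpoint is
    determined up to sign. *)
Lemma jrel_qmod x y :
  jrel s' t' (qmod x) (qmod y) = jrel s t x y || jrel s t x (f y).
Proof.
apply/idP/idP.
  have step (r : {perm 'I_(2 * n)}) (r' : {perm 'I_n}) z :
      (forall w, r (f w) = f (r w)) -> (forall w, qmod (r w) = r' (qmod w)) ->
      (forall w, jrel s t w (r w)) ->
      (forall w, qmod w = z -> jrel s t x w || jrel s t x (f w)) ->
      (forall w, qmod w = r' z -> jrel s t x w || jrel s t x (f w)).
    move=> rf rq rj Pz w qw.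
    have H : jrel s t x (r (qlift z)) || jrel s t x (f (r (qlift z))).
      case/orP: (Pz _ (qliftK z)) => h; apply/orP; [left|right].
        exact: jrel_trans h (rj _).
      by rewrite -rf; apply: jrel_trans h (rj _).
    have e : qmod (r (qlift z)) = qmod w by rewrite rq qliftK qw.
    have [->//|->] := qmod_eq e.
    by rewrite fK orbC.
  move=> h.
  apply: (jrel_ind (P := fun z => forall w, qmod w = z ->
           jrel s t x w || jrel s t x (f w)) h) => //.
  - move=> w /esym/qmod_eq[->|->]; first by rewrite jrel_refl.
    by rewrite fK jrel_refl orbT.
  - by move=> z; apply: (step s s') => // w; apply/jrel_orbl/mem_porbit_perm.
  - by move=> z; apply: (step t t') => // w; apply/jrel_orbr/mem_porbit_perm.
have half v : jrel s t x v -> jrel s' t' (qmod x) (qmod v).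
  move=> h; apply: (jrel_ind (P := fun w => jrel s' t' (qmod x) (qmod w)) h).
  - exact: jrel_refl.
  - move=> z uz; apply: jrel_trans uz _; rewrite sq.
    exact/jrel_orbl/mem_porbit_perm.
  - move=> z uz; apply: jrel_trans uz _; rewrite tq.
    exact/jrel_orbr/mem_porbit_perm.
by case/orP=> /half //; rewrite qmod_rot.
Qed.

Lemma norb_qmod : norb s t =
  norb s' t' + #|[set K in eqclasses (jrel s t) | negB K != K]| %/ 2.
Proof.
apply: (card_classes_quotient (q := @qmod n)) fK _ jrel_qmod;
  try exact: jrel_refl; try exact: jrel_sym; try exact: jrel_trans.
  exact: jrel_rot.
by move=> u; exists (qlift u); apply: qliftK.
Qed.

End QuotientCount.

Lemma orel_qmod n (s : {perm 'I_(2 * n)}) (s' : {perm 'I_n}) :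
    (forall x, s (Defs.rot n x) = Defs.rot n (s x)) ->
    (forall x, qmod (s x) = s' (qmod x)) ->
  forall x y, orel s' (qmod x) (qmod y) = orel s x y || orel s x (Defs.rot n y).
Proof. by move=> sf sq x y; rewrite !orelE (jrel_qmod sf sf sq sq). Qed.

Lemma cyc_qmod n (s : {perm 'I_(2 * n)}) (s' : {perm 'I_n}) :
    (forall x, s (Defs.rot n x) = Defs.rot n (s x)) ->
    (forall x, qmod (s x) = s' (qmod x)) ->
  cyc s = cyc s' + #|[set K in porbits s | negB K != K]| %/ 2.
Proof.
move=> sf sq; rewrite -!norb_diag (norb_qmod sf sf sq sq) porbitsE.
by rewrite (eq_classes (orelE s)).
Qed.

(** * The permutation of a non-crossing partition *)

Section BlockPerm.

Variables (n : nat) (P : {set {set 'I_(2 * n)}}).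
Hypothesis partP : partition P setT.

Let triv : trivIset P. Proof. by case/and3P: partP. Qed.
Let cov p : p \in cover P.
Proof. by case/and3P: partP => /eqP-> _ _; rewrite inE. Qed.

Lemma mem_pblockT p : p \in pblock P p. Proof. by rewrite mem_pblock. Qed.

Lemma pblock_eq p q : q \in pblock P p -> pblock P q = pblock P p.
Proof. by move=> h; apply/eqP; rewrite eq_sym eq_pblock. Qed.

(** The shift by 1 gives [q = p] the largest value, [m - 1], so a minimum over a block is reached at
    [p] only when the block is a singleton. *)
Lemma cdistE (p q m : nat) : p < m -> q < m ->
  (q + m - p - 1) %% m = if p < q then q - p - 1 else q + m - p - 1.
Proof.
move=> hp hq; case: ltnP => h; last by rewrite modn_small; lia.
have -> : q + m - p - 1 = (q - p - 1) + m by lia.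
by rewrite modnDr modn_small; lia.
Qed.

Lemma nextbP p : nextb P p \in pblock P p /\
  forall r, r \in pblock P p -> ~~ btw p r (nextb P p).
Proof.
rewrite /nextb; case: arg_minnP => [|q qB qmin]; first exact: mem_pblockT.
split=> // r /qmin; rewrite !cdistE //.
have := ltn_ord p; have := ltn_ord q; have := ltn_ord r; rewrite /btw.
by case: (ltnP p q); case: (ltnP p r); lia.
Qed.

Lemma prevbP p : prevb P p \in pblock P p /\
  forall r, r \in pblock P p -> ~~ btw (prevb P p) r p.
Proof.
rewrite /prevb; case: arg_minnP => [|q qB qmin]; first exact: mem_pblockT.
split=> // r /qmin; rewrite !cdistE //.
have := ltn_ord p; have := ltn_ord q; have := ltn_ord r; rewrite /btw.
by case: (ltnP q p); case: (ltnP r p); lia.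
Qed.

Lemma nextb_uniq p q : q \in pblock P p ->
  (forall r, r \in pblock P p -> ~~ btw p r q) -> nextb P p = q.
Proof.
move=> qB qmin; have [nB nmin] := nextbP p; apply/eqP; apply: contraT => neq.
have := @btw_total p (nextb P p) q neq.
by rewrite (negbTE (nmin _ qB)) (negbTE (qmin _ nB)).
Qed.

Lemma prevbK : cancel (prevb P) (nextb P).
Proof.
move=> p; have [pB pmin] := prevbP p.
by apply: nextb_uniq; rewrite (pblock_eq pB) // mem_pblockT.
Qed.

Lemma nextb_inj : injective (nextb P).
Proof.
apply: can_inj (prevb P) _; have [g gK Kg] := injF_bij (can_inj prevbK).
by move=> p; rewrite -[in LHS](Kg p) prevbK Kg.
Qed.

Definition nperm : {perm 'I_(2 * n)} := perm nextb_inj.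

Lemma npermE p : nperm p = nextb P p. Proof. by rewrite permE. Qed.

Lemma npermVE p : (nperm^-1)%g p = prevb P p.
Proof. by apply: (@perm_inj _ nperm); rewrite permKV npermE prevbK. Qed.

Lemma porbit_nperm p : porbit nperm p = pblock P p.
Proof.
apply/eqP; rewrite eqEsubset; apply/andP; split; apply/subsetP=> r.
  move=> h; apply: (porbit_ind (P := fun z => z \in pblock P p) h).
    exact: mem_pblockT.
  by move=> z zp; rewrite npermE -(pblock_eq zp); case: (nextbP z).
move=> rB; apply: contraT => nr.
(* Anticlockwise distance from [o] to [r], equal to [2n] at [r]. From the closest [o] in the orbit,
   the next step must get closer, reach [r] or jump over it; the last is excluded as [r] is in the
   block. *)
pose dist (o : 'I_(2 * n)) := if o < r then r - o else r + 2 * n - o.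
case: (@arg_minnP _ p (fun o => o \in porbit nperm p) dist (porbit_id _ _)).
move=> o oO /(_ (nperm o)); rewrite {1}/dist.
have eqo : porbit nperm o = porbit nperm p by apply/eqP; rewrite eq_porbit_mem.
have sO : nperm o \in porbit nperm p by rewrite -eqo mem_porbit_perm.
have oB : o \in pblock P p.
  apply: (porbit_ind (P := fun z => z \in pblock P p) oO) => [|z zp].
    exact: mem_pblockT.
  by rewrite npermE -(pblock_eq zp); case: (nextbP z).
have [_ /(_ r)] := nextbP o; rewrite (pblock_eq oB) -npermE => /(_ rB) nb /(_ sO).
have neq : (nperm o : nat) != r by apply: contraNneq nr => /ord_inj <-.
have neqo : (o : nat) != r by apply: contraNneq nr => /ord_inj <-.
have := ltn_ord o; have := ltn_ord (nperm o); have := ltn_ord r.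
move: nb neq neqo; rewrite /btw /dist.
by case: (ltnP o r) => ?; case: (ltnP (nperm o) r) => ?; lia.
Qed.

Lemma porbits_nperm : porbits nperm = P.
Proof.
apply/setP=> K; apply/imsetP/idP => [[p _ ->]|KP].
  by rewrite porbit_nperm pblock_mem.
have [p pK] : exists p, p \in K.
  by apply/set0Pn; apply: contraTneq KP => ->; case/and3P: partP.
by exists p => //; rewrite porbit_nperm (def_pblock triv KP pK).
Qed.

Lemma same_blockE x y :
  [exists K in P, (x \in K) && (y \in K)] = orel nperm x y.
Proof.
rewrite /orel porbit_nperm; apply/existsP/idP => [[K /and3P[KP xK yK]]|yB].
  by rewrite (def_pblock triv KP xK).
by exists (pblock P x); rewrite pblock_mem // mem_pblockT.
Qed.

Lemma nperm_rot : [forall K in P, negB K \in P] ->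
  forall x, nperm (Defs.rot n x) = Defs.rot n (nperm x).
Proof.
move=> /forallP negP x; rewrite !npermE; have [nB nmin] := nextbP x.
have bE : pblock P (Defs.rot n x) = negB (pblock P x).
  apply: def_pblock => //; last by apply: imset_f; apply: mem_pblockT.
  by have := negP (pblock P x); rewrite pblock_mem.
apply: nextb_uniq; rewrite bE; first exact: imset_f.
move=> _ /imsetP[r rB ->]; apply: contra (nmin r rB).
rewrite !(@rot_halfE (2 * n) n) // /btw.
have := ltn_ord x; have := ltn_ord r; have := ltn_ord (nextb P x).
move: (nat_of_ord (nextb P x)) (nat_of_ord r) (nat_of_ord x) => u v w hu hv hw.
by case: (ltnP u n); case: (ltnP v n); case: (ltnP w n); lia.
Qed.

(** The definition forbids crossings of chords only. Crossing elements of two distinct blocks are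
    moved inwards until they bound two crossing chords. *)
Lemma noncrossing_blocks : noncrossing P ->
  forall a b c d : 'I_(2 * n), a < c -> c < b -> b < d ->
  b \in pblock P a -> d \in pblock P c -> pblock P a = pblock P c.
Proof.
move=> nc a b c d ac cb bd bA dC; apply/eqP; apply: contraT => neq.
set A := pblock P a in bA neq; set C := pblock P c in dC neq.
have disj z : z \in A -> z \in C -> False.
  by move=> zA zC; case/eqP: neq; rewrite /A -(pblock_eq zA) (pblock_eq zC).
have cC : c \in C by apply: mem_pblockT.
have aA : a \in A by apply: mem_pblockT.
(* The chord from [a1] to [b1] is the one of [A] passing over [c]; the chord from [c1] to [d1] is
   then the one of [C] passing over [b1]. *)
have [a1 /andP[a1A a1c] a1max] :=
  @arg_maxnP _ a (fun z => (z \in A) && (z < c)) (fun z => z)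
    (introT andP (conj aA ac)).
have [b1 /andP[b1A b1c] b1min] :=
  @arg_minnP _ b (fun z => (z \in A) && (c < z)) (fun z => z)
    (introT andP (conj bA cb)).
have b1b : b1 <= b by apply: b1min; rewrite bA.
have [c1 /andP[c1C c1b] c1max] :=
  @arg_maxnP _ c (fun z => (z \in C) && (z < b1)) (fun z => z)
    (introT andP (conj cC b1c)).
have b1d : b1 < d by apply: leq_ltn_trans bd.
have [d1 /andP[d1C d1b] d1min] :=
  @arg_minnP _ d (fun z => (z \in C) && (b1 < z)) (fun z => z)
    (introT andP (conj dC b1d)).
have c1c : c <= c1 by apply: c1max; rewrite cC.
have neqz z w : z \in A -> w \in C -> (z : nat) != w.
  by move=> zA wC; apply/eqP=> /ord_inj e; apply: (disj z) => //; rewrite e.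
have ch1 : chord P a1 b1.
  rewrite /chord (ltn_trans a1c b1c); apply/existsP; exists A.
  rewrite pblock_mem // a1A b1A /=; apply/forallP=> k; apply/implyP=> kA.
  apply/negP=> /andP[h1 h2]; case: (ltngtP k c) (neqz k c kA cC) => // kc _.
    by have := a1max k; rewrite kA kc => /(_ isT); rewrite /= leqNgt h1.
  by have := b1min k; rewrite kA kc => /(_ isT); rewrite leqNgt h2.
have ch2 : chord P c1 d1.
  rewrite /chord (ltn_trans c1b d1b); apply/existsP; exists C.
  rewrite pblock_mem // c1C d1C /=; apply/forallP=> k; apply/implyP=> kC.
  apply/negP=> /andP[h1 h2]; case: (ltngtP b1 k) (neqz b1 k b1A kC) => // kb _.
    by have := d1min k; rewrite kC kb => /(_ isT); rewrite leqNgt h2.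
  by have := c1max k; rewrite kC kb => /(_ isT); rewrite /= leqNgt h1.
move/forallP/(_ a1)/forallP/(_ b1)/forallP/(_ c1)/forallP/(_ d1): nc.
by rewrite ch1 ch2 c1b d1b (leq_trans a1c c1c).
Qed.

Lemma ncperm_nperm : noncrossing P -> ncperm nperm.
Proof.
move=> nc x y; rewrite !npermE => xy; apply: contraT => nxy.
have [xB xmin] := nextbP x; have [yB ymin] := nextbP y.
set x' := nextb P x in xB xmin xy nxy *; set y' := nextb P y in yB ymin nxy *.
have neq : pblock P x != pblock P y.
  apply/eqP=> e; have := xmin y; rewrite e mem_pblockT xy => /(_ isT) //.
have sx := pblock_eq xB; have sy := pblock_eq yB.
have ne u v : pblock P u = pblock P x -> pblock P v = pblock P y ->
    (u : nat) != v.
  by move=> ux vy; apply/eqP=> /ord_inj e; rewrite -ux e vy eqxx in neq.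
have n1 := ne x y' erefl sy; have n2 := ne x' y' sx sy.
have cross (a b c d : 'I_(2 * n)) : pblock P a = pblock P b ->
    pblock P c = pblock P d -> pblock P a != pblock P c ->
    ~~ [&& a < c, c < b & b < d].
  move=> ab cd; apply: contra => /and3P[ac cb bd]; apply/eqP.
  by apply: (noncrossing_blocks nc ac cb bd); rewrite ?ab ?cd mem_pblockT.
have nyx : pblock P y != pblock P x by rewrite eq_sym.
(* The cyclic order [x], [y], [x'], [y'] of a violation can be cut open at four places; each of [k1]
   to [k4] excludes one resulting linear order. *)
have k1 := @cross x x' y y' (esym sx) (esym sy) neq.
have k2 := @cross y' y x x' sy (esym sx); rewrite sy in k2.
have k3 := @cross x' x y' y sx sy; rewrite sx sy in k3.
have k4 := @cross y y' x' x (esym sy) sx; rewrite sx in k4.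
move: k1 (k2 nyx) (k3 neq) (k4 nyx) xy nxy n1 n2; rewrite /btw.
move: (nat_of_ord x) (nat_of_ord x') (nat_of_ord y) (nat_of_ord y') => u u' v v'.
case: (ltngtP u u') => uu; case: (ltnP v u) => vu; case: (ltnP v' u) => v'u; lia.
Qed.

End BlockPerm.

(** * Circles *)

Section Circles.

Variables (n : nat) (P Q : {set {set 'I_(2 * n)}}).
Hypotheses (partP : partition P setT) (partQ : partition Q setT).

Let sP := nperm partP.
Let sQ := nperm partQ.
Let s := (sP * sQ^-1)%g.
Let circle_edge (x y : 'I_(4 * n)) :=
  [|| betaB P x == y, betaB P y == x, betaB Q x == y | betaB Q y == x].

Lemma lab_ptm (p : 'I_(2 * n)) : lab (ptm p) = p.
Proof. by apply: ord_inj; rewrite /=; lia. Qed.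

Lemma lab_ptp (p : 'I_(2 * n)) : lab (ptp p) = p.
Proof. by apply: ord_inj; rewrite /=; lia. Qed.

Lemma odd_ptm (p : 'I_(2 * n)) : odd (ptm p) = false.
Proof. by rewrite /=; lia. Qed.

Lemma odd_ptp (p : 'I_(2 * n)) : odd (ptp p).
Proof. by rewrite /=; lia. Qed.

Lemma ptmp_lab (x : 'I_(4 * n)) : x = if odd x then ptp (lab x) else ptm (lab x).
Proof. by apply: ord_inj; case: ifP => /=; lia. Qed.

(* The label [p] such that the arc of [betaB Q] through [x] leaves the point
   just after [p]. *)
Definition circle_label (x : 'I_(4 * n)) : 'I_(2 * n) :=
  if odd x then lab x else (sQ^-1)%g (lab x).

Lemma circle_label_ptp p : circle_label (ptp p) = p.
Proof. by rewrite /circle_label odd_ptp lab_ptp. Qed.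

Lemma circle_label_ptm p : circle_label (ptm p) = (sQ^-1)%g p.
Proof. by rewrite /circle_label odd_ptm lab_ptm. Qed.

Lemma betaB_ptp p : betaB P (ptp p) = ptm (sP p).
Proof. by rewrite /betaB odd_ptp lab_ptp npermE. Qed.

Lemma betaB_ptm p : betaB Q (ptm p) = ptp ((sQ^-1)%g p).
Proof. by rewrite /betaB odd_ptm lab_ptm npermVE. Qed.

Lemma circle_label_betaQ x : circle_label (betaB Q x) = circle_label x.
Proof.
rewrite [in RHS]/circle_label /betaB; case: ifP => _.
  by rewrite circle_label_ptm -npermE permK.
by rewrite circle_label_ptp npermVE.
Qed.

Lemma orel_circle_label_betaP x :
  orel s (circle_label x) (circle_label (betaB P x)).
Proof.
rewrite {1}/circle_label /betaB; case: ifP => _.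
  rewrite circle_label_ptm -(npermE partP).
  by have := mem_porbit_perm s (lab x); rewrite permM.
rewrite circle_label_ptp -(npermVE partP) orel_sym.
by have := mem_porbit_perm s ((sP^-1)%g (lab x)); rewrite permM permKV.
Qed.

Lemma circle_edge_sym : symmetric circle_edge.
Proof.
move=> x y; rewrite /circle_edge.
by case: (betaB P x == y); case: (betaB Q x == y); rewrite ?orbT ?orbF.
Qed.

(** Two consecutive arcs lead from the point after [p] to the point before [sP p], then to the point
    after [(sQ^-1) (sP p)]. A circle thus follows one cycle of [s]. *)
Lemma connect_circle x y :
  connect circle_edge x y = orel s (circle_label x) (circle_label y).
Proof.
apply/idP/idP.
  case/connectP=> p; elim: p x => [|z p IH] x /=; first by move=> _ ->; apply: orel_refl.
  case/andP=> xz pp yl; apply: orel_trans (IH z pp yl).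
  case/or4P: xz => /eqP<-.
  - exact: orel_circle_label_betaP.
  - by rewrite orel_sym; apply: orel_circle_label_betaP.
  - by rewrite circle_label_betaQ; apply: orel_refl.
  - by rewrite circle_label_betaQ; apply: orel_refl.
have csym := sym_connect_sym circle_edge_sym.
have rep z : connect circle_edge z (ptp (circle_label z)).
  rewrite {1}(ptmp_lab z) /circle_label; case: ifP => _; first exact: connect0.
  by apply: connect1; rewrite /circle_edge betaB_ptm eqxx !orbT.
move=> h; apply: connect_trans (rep x) _; rewrite csym.
apply: connect_trans (rep y) _; rewrite csym.
apply: (porbit_ind (P := fun w => connect circle_edge (ptp (circle_label x)) (ptp w)) h).
  exact: connect0.
move=> z xz; apply: connect_trans xz _; apply: (@connect_trans _ _ (ptm (sP z))).
  by apply: connect1; rewrite /circle_edge betaB_ptp eqxx.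
by apply: connect1; rewrite /circle_edge betaB_ptm permM eqxx !orbT.
Qed.

Let fourn : (4 * n = 2 * (2 * n))%N. Proof. by lia. Qed.

Lemma card_circles : #|circles (betaB P) (betaB Q)| = cyc s.
Proof.
(* For the identity involution no class is moved, so the added term vanishes and the quotient count
   becomes a plain bijection of classes. *)
have -> : cyc s = cyc s +
    #|[set K in circles (betaB P) (betaB Q) | [set id x | x in K] != K]| %/ 2.
  rewrite (_ : [set _ in _ | _] = set0) ?cards0 ?addn0 //.
  by apply/setP=> K; rewrite !inE imset_id eqxx andbF.
rewrite {1}/cyc porbitsE.
apply: (card_classes_quotient (F := id) (q := circle_label)) => //;
  try exact: orel_refl; try exact: orel_sym; try exact: orel_trans.
- exact: sym_connect_sym circle_edge_sym.
- exact: connect_trans.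
- by move=> p; exists (ptp p); apply: circle_label_ptp.
- by move=> x y; rewrite orbb connect_circle.
Qed.

Hypothesis sQf : forall x, sQ (Defs.rot n x) = Defs.rot n (sQ x).
Hypothesis sPf : forall x, sP (Defs.rot n x) = Defs.rot n (sP x).

Lemma permV_rot (r : {perm 'I_(2 * n)}) :
  (forall x, r (Defs.rot n x) = Defs.rot n (r x)) ->
  forall x, (r^-1)%g (Defs.rot n x) = Defs.rot n ((r^-1)%g x).
Proof. by move=> rf x; apply: (@perm_inj _ r); rewrite rf !permKV. Qed.

Let sf x : s (Defs.rot n x) = Defs.rot n (s x).
Proof. by rewrite !permM sPf permV_rot. Qed.

Lemma circle_label_rot x :
  circle_label (Defs.rot (2 * n) x) = Defs.rot n (circle_label x).
Proof.
have rE := rot_halfE x fourn; have ltx := ltn_ord x.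
have oE : odd (Defs.rot (2 * n) x) = odd x.
  by rewrite rE; case: ltnP => h; lia.
have lE : lab (Defs.rot (2 * n) x) = Defs.rot n (lab x).
  apply: ord_inj; rewrite (@rot_halfE (2 * n) n) //.
  have labE (y : 'I_(4 * n)) : lab y = y./2 :> nat by [].
  rewrite !labE rE.
  by case: (ltnP x (2 * n)) => h; case: (ltnP x./2 n) => h'; lia.
by rewrite /circle_label oE lE; case: ifP => // _; rewrite permV_rot.
Qed.

Lemma card_circles_qmod (s' : {perm 'I_n}) :
    (forall x, qmod (s x) = s' (qmod x)) ->
  #|circles (betaB P) (betaB Q)| = cyc s' + cd (betaB P) (betaB Q).
Proof.
move=> sq; rewrite /cyc porbitsE.
apply: (card_classes_quotient (F := @Defs.rot (4 * n) (2 * n))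
  (q := fun x => qmod (circle_label x))) => //;
  try exact: orel_refl; try exact: orel_sym; try exact: orel_trans.
- exact: sym_connect_sym circle_edge_sym.
- exact: connect_trans.
- by move=> x y; rewrite !connect_circle !circle_label_rot !orelE jrel_rot.
- exact: rot_half_inv.
- by move=> u; exists (ptp (qlift u)); rewrite circle_label_ptp qliftK.
- move=> x y; rewrite !connect_circle circle_label_rot.
  exact: orel_qmod.
Qed.

End Circles.

(** * The relation between the numbers of non-zero classes *)

Lemma joinPE n (P Q : {set {set 'I_(2 * n)}})
    (partP : partition P setT) (partQ : partition Q setT) :
  joinP P Q = eqclasses (jrel (nperm partQ) (nperm partP)).
Proof.
apply: eq_classes => x y; apply: eq_connect => u v.
by rewrite !same_blockE orbC.
Qed.

Lemma nzbk_relation n (P Q : {set {set 'I_(2 * n)}}) : ncB P -> ncB Q ->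
  2 * nzbk (joinP P Q) + n = cd (betaB P) (betaB Q) + nzbk P + nzbk Q.
Proof.
case/andP=> /and3P[partP symP _] ncP /andP[/and3P[partQ symQ _] ncQ].
have sPf := nperm_rot partP symP; have sQf := nperm_rot partQ symQ.
have sPq x := esym (qpermE sPf x); have sQq x := esym (qpermE sQf x).
set sP := nperm partP in sPf sPq; set sQ := nperm partQ in sQf sQq.
pose tP := qperm sPf; pose tQ := qperm sQf.
have ncsP : ncperm sP by apply: ncperm_nperm.
have ncsQ : ncperm sQ by apply: ncperm_nperm.
(* With [sQ] first, the third cycle count is that of [sP * sQ^-1], which counts circles. *)
have := ncperm_genus0 ncsQ ncsP.
have := ncperm_genus0 (ncperm_qperm (sf := sQf) ncsQ) (ncperm_qperm (sf := sPf) ncsP).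
have cP : cyc sP = cyc tP + nzbk P.
  by rewrite (cyc_qmod sPf sPq) porbits_nperm.
have cQ : cyc sQ = cyc tQ + nzbk Q.
  by rewrite (cyc_qmod sQf sQq) porbits_nperm.
have cJ : norb sQ sP = norb tQ tP + nzbk (joinP P Q).
  by rewrite (norb_qmod sQf sPf sQq sPq) (joinPE partP partQ).
have sq x : qmod ((sP * sQ^-1)%g x) = (tP * tQ^-1)%g (qmod x).
  by rewrite !permM; apply: (@perm_inj _ tQ); rewrite permKV -sQq permKV sPq.
have cC := card_circles_qmod sQf sPf sq; rewrite card_circles in cC.
rewrite -/sP -/sQ in cC; rewrite /ncyc -/tP -/tQ cC cP cQ cJ; lia.
Qed.

Theorem theorem2 (n : nat) (P Q : {set {set 'I_(2*n)}}) :
  (0 < n)%N -> ncB P -> ncB Q ->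
  (* combinatorial form *)
  ((2 * nzbk (joinP P Q))%:Z
     = (cd (betaB P) (betaB Q) + nzbk P + nzbk Q)%:Z - n%:Z)%R
  /\
  (* matrix-entry form: J^B_n(delta^2) = P^B G^B_n(1,delta) P^B at (P,Q),
     with delta^(k - n/2) = delta^k / (sqrt delta)^n *)
  (forall (R : rcfType) (delta : R), (0 < delta)%R ->
     ((delta ^+ 2) ^+ nzbk (joinP P Q)
      = (delta ^+ nzbk P / Num.sqrt delta ^+ n)
        * ((1 ^+ c0 (betaB P) (betaB Q)) * delta ^+ cd (betaB P) (betaB Q))
        * (delta ^+ nzbk Q / Num.sqrt delta ^+ n))%R).
Proof.
move=> _ ncP ncQ; have E := nzbk_relation ncP ncQ; split.
  by rewrite -E PoszD addrK.
move=> R delta d0; have rn0 : (Num.sqrt delta ^+ n != 0)%R.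
  by rewrite expf_neq0 // sqrtr_eq0 -ltNge.
have rr : (Num.sqrt delta ^+ n * Num.sqrt delta ^+ n = delta ^+ n)%R.
  by rewrite -exprMn -expr2 sqr_sqrtr // ltW.
rewrite expr1n mul1r -exprM.
(* Multiplying twice by the [n]-th power of the square root clears both denominators and turns the
   left side into [delta] to the power [2 * nzbk (joinP P Q) + n]. *)
apply: (mulIf rn0); apply: (mulIf rn0).
rewrite -[LHS]mulrA rr -exprD E !exprD.
move: (delta ^+ _)%R (delta ^+ _)%R (delta ^+ _)%R rn0 => u v w rn0 {rr}.
by move: (Num.sqrt _ ^+ n)%R rn0 => a a0; field.
Qed.
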